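(* Consider the compromise game with compromise payoff $B\in(0,1/2]$ described in the context. Let $\tilde S$ be the set of indifferent types of sym-QRE, i.e. the set of all $\tilde x(\sigma)$ with $\sigma\in\Sigma$ a sym-QRE, where $\tilde x(\sigma)$ is the type with $\Delta\bar u_{\tilde x(\sigma)}(\sigma)=0$. Then $\tilde S=(0,B)$, and a strategy $\sigma\in\Sigma$ is a sym-QRE if and only if: (i) $\sigma$ is continuous and strictly increasing; (ii) $\sigma(x)\in(0,1)$ for all $x\in\mathcal X$; (iii) there exists a unique indifferent type $\tilde x\in\tilde S=(0,B)$ such that $\sigma(\tilde x)=\frac12$ and $\tilde x=G_\sigma^{-1}(B)$; (iv) $\sigma$ is symmetric, i.e. for all $x,x'\in\mathcal X$, $\sigma(x)=1-\sigma(x')\iff\Delta\bar u_x(\sigma)=-\Delta\bar u_{x'}(\sigma)$.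
   Context: Compromise game. Two players simultaneously choose to fight (action 1) or flee (action 0). Each has a private strength (type) $x$ uniform on $\mathcal X=[0,1]$, i.i.d. across players. If at least one player fights, the stronger player receives 1 and the weaker 0; if both flee, each receives $B$. $\Sigma$ is the set of Lebesgue measurable $\sigma:[0,1]\to[0,1]$, $\sigma(x)$ being the probability that type $x$ fights; both players use the same $\sigma$. Expected payoffs are $\bar u^1_x(\sigma)=x$ and $\bar u^0_x(\sigma)=\int_0^x\sigma(x')\,dx'+B\int_0^1(1-\sigma(x'))\,dx'$; write $\bar u_x(\sigma)=(\bar u^1_x(\sigma),\bar u^0_x(\sigma))$, $\Delta\bar u_x(\sigma)=\bar u^1_x(\sigma)-\bar u^0_x(\sigma)$. $G_\sigma(x)=\int_0^x(1-\sigma(x'))\,dx'\big/\int_0^1(1-\sigma(x'))\,dx'$ is the c.d.f. of types conditional on fleeing, and $G_\sigma^{-1}$ is its inverse; thus $\Delta\bar u_x(\sigma)=(G_\sigma(x)-B)\int_0^1(1-\sigma(x'))\,dx'$. Sym-QRE. $\sigma\in\Sigma$ is a sym-QRE if there exists $Q:\mathbb R^2\to[0,1]$ with $\sigma(x)=Q(\bar u_x(\sigma))$ for all $x\in[0,1]$ satisfying, with $v=(v^1,v^0)$: (R1) $Q(v)\in(0,1)$ for all $v$; (R2) $Q$ is continuous; (R3) $\frac{\partial Q(v)}{\partial v^1}>0>\frac{\partial Q(v)}{\partial v^0}$ for all $v\in\mathbb R^2$; (R4) $v^1>v^0\iff Q(v)>1-Q(v)$; (S1) $Q(v+\gamma(1,1))=Q(v)$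 for all $v\in\mathbb R^2,\gamma\in\mathbb R$; (S2) $Q(v^1,v^0)=1-Q(v^0,v^1)$ for all $(v^1,v^0)\in\mathbb R^2$.
   Formalization: With (R3) as partial derivatives the ''if'' part is false (σ may have zero slope or a kink), so (i) also requires σ to have a positive derivative on [0,1], one-sided at the ends; the unchanged (i)–(iv) is proved for (R3) read as strict monotonicity of Q. *)

(* Defs.v *)
From HB Require Import structures.
From mathcomp Require Import all_boot all_order all_algebra.
From mathcomp Require Import all_classical all_reals all_analysis.

Set Implicit Arguments.
Unset Strict Implicit.
Unset Printing Implicit Defensive.

Import Order.TTheory GRing.Theory Num.Theory.
Import numFieldNormedType.Exports.
Local Open Scope classical_set_scope.
Local Open Scope ring_scope.

(* R with the Lebesgue measurable sets (those of the domain of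
   completed_lebesgue_measure), whereas measurableTypeR only has the Borel
   sets; see completed_caratheodory_measurable. *)
Notation lebesgueR R := (caratheodory_type ((@wlength R idfun)^*)%mu).

Section CompromiseGame.
Context {R : realType}.
Implicit Types (B x : R) (sigma : R -> R).

(* Strategies are functions on R; only their values on [0, 1] are ever used. *)
Definition strategy sigma : Prop :=
  measurable_fun ((`[0, 1] : set R) : set (lebesgueR R)) sigma /\
  forall x, x \in `[0, 1] -> 0 <= sigma x <= 1.

Definition itv_integral (f : R -> R) (a b : R) : R :=
  Rintegral (@completed_lebesgue_measure R) (`[a, b] : set R) f.

Definition u_fight x sigma : R := x.

Definition u_flee B x sigma : R :=
  itv_integral sigma 0 x + B * itv_integral (fun t => 1 - sigma t) 0 1.

Definition payoffs B x sigma : R * R := (u_fight x sigma, u_flee B x sigma).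

Definition payoff_gap B x sigma : R := u_fight x sigma - u_flee B x sigma.

Definition flee_cdf sigma x : R :=
  itv_integral (fun t => 1 - sigma t) 0 x / itv_integral (fun t => 1 - sigma t) 0 1.

(* The library's inverse of the restriction of flee_cdf sigma to [0, 1], with
   default value 0 off its image; if sigma < 1 on [0, 1] then flee_cdf sigma is
   a bijection of [0, 1] onto itself and this is its genuine inverse. *)
Definition flee_cdf_inv sigma : R -> R :=
  'pinv_(fun=> 0) (`[0, 1] : set R) (flee_cdf sigma).

(* Responsiveness: dQ/dv1 > 0 > dQ/dv0 at every point of the plane. *)
Definition responsive (Q : R * R -> R) : Prop :=
  forall v : R * R,
    [/\ derivable (fun t : R => Q (t, v.2)) v.1 1,
        0 < derive1 (fun t : R => Q (t, v.2)) v.1,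
        derivable (fun t : R => Q (v.1, t)) v.2 1 &
        derive1 (fun t : R => Q (v.1, t)) v.2 < 0].

(* The order-theoretic form of responsiveness, without differentiability. It is
   needed because a continuous strictly increasing strategy can have a kink or
   a zero slope: payoff_gap B x sigma is then C^1 in x with derivative
   1 - sigma x > 0, so no Q generating sigma can satisfy responsive. *)
Definition strictly_responsive (Q : R * R -> R) : Prop :=
  (forall a a' b : R, a < a' -> Q (a, b) < Q (a', b)) /\
  (forall a b b' : R, b < b' -> Q (a, b') < Q (a, b)).

Definition interior_valued (Q : R * R -> R) : Prop := forall v, 0 < Q v < 1.

Definition payoff_monotone (Q : R * R -> R) : Prop :=
  forall v : R * R, v.1 > v.2 <-> Q v > 1 - Q v.

Definition translation_invariant (Q : R * R -> R) : Prop :=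
  forall (v : R * R) (c : R), Q (v.1 + c, v.2 + c) = Q v.

Definition label_independent (Q : R * R -> R) : Prop :=
  forall a b : R, Q (a, b) = 1 - Q (b, a).

(* resp is the form of responsiveness imposed on Q: responsive or
   strictly_responsive. *)
Definition sym_QRE (resp : (R * R -> R) -> Prop) B sigma : Prop :=
  exists Q : R * R -> R,
    (forall x, x \in `[0, 1] -> sigma x = Q (payoffs B x sigma)) /\
    [/\ interior_valued Q, continuous Q, resp Q & payoff_monotone Q] /\
    translation_invariant Q /\ label_independent Q.

Definition indifferent B sigma x : Prop :=
  x \in `[0, 1] /\ payoff_gap B x sigma = 0.

(* unique P x is Corelib's "x satisfies P and is the only one to do so". *)
Definition indifferent_types (resp : (R * R -> R) -> Prop) B : set R :=
  [set x | exists sigma,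
    [/\ strategy sigma, sym_QRE resp B sigma & unique (indifferent B sigma) x]].

Definition qre_shape B sigma : Prop :=
  [/\ {within `[0, 1], continuous sigma} /\
        {in `[0, 1] &, {homo sigma : x y / x < y}},
      forall x, x \in `[0, 1] -> 0 < sigma x < 1,
      exists x, [/\ x \in `]0, B[, unique (indifferent B sigma) x,
                    sigma x = 2^-1 & x = flee_cdf_inv sigma B] &
      forall x x', x \in `[0, 1] -> x' \in `[0, 1] ->
        (sigma x = 1 - sigma x' <->
         payoff_gap B x sigma = - payoff_gap B x' sigma)].

(* sigma is differentiable on [0, 1] with positive derivative, one-sided at 0
   and 1: the regularity that responsive adds to qre_shape. *)
Definition pos_derivative sigma : Prop :=
  forall x, x \in `[0, 1] -> exists2 l : R, 0 < l &
    (sigma y - sigma x) / (y - x) @[y --> within `[0, 1] x^'] --> l.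

End CompromiseGame.

(* Main.v *)
Require Import Defs.
From HB Require Import structures.
From mathcomp Require Import all_boot all_order all_algebra.
From mathcomp Require Import all_classical all_reals all_analysis.
From mathcomp Require Import measurable_realfun ring lra.

Set Implicit Arguments.
Unset Strict Implicit.
Unset Printing Implicit Defensive.

Import Order.TTheory GRing.Theory Num.Theory.
Import numFieldNormedType.Exports.
Local Open Scope classical_set_scope.
Local Open Scope ring_scope.

(* By translation invariance and label independence a rule Q is a function h of
   the payoff difference with h (- d) = 1 - h d, so sigma is a sym-QRE exactly
   when sigma = h o gap, where gap is the payoff gap, an antiderivative of
   1 - sigma. If h is given, gap is increasing, hence so is sigma; its zero lies
   below B because gap is strictly concave. Conversely, sigma o gap^-1 prescribes
   h on the range of gap, its reflection covers the rest of
   [- gap 1, gap 1] because B <= 1/2, and (iv) makes the two agree.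
   Each x0 in (0, B) is attained for h linear near 0: gap then solves a linear
   ODE, giving sigma x = 1 - exp (- c (x - x0)) / 2, with c determined by
   1 - exp (- c x0) = B (1 - exp (- c)). *)

(** * Integrals of strategies over subintervals of [0, 1] *)

Section StrategyIntegrals.
Context {R : realType}.
Implicit Types (B a b x y : R) (sigma : R -> R).

Notation mu := (@completed_lebesgue_measure R).

Lemma borel_lebesgue_measurable (A : set R) :
  measurable (A : set (measurableTypeR R)) -> measurable (A : set (lebesgueR R)).
Proof. exact: sub_caratheodory. Qed.

Lemma lebesgueR_measurable_itv (i : interval R) :
  measurable ([set` i] : set (lebesgueR R)).
Proof. by apply: borel_lebesgue_measurable; exact: measurable_itv. Qed.

Lemma completed_lebesgue_measure_itv (b1 b2 : bool) x y : x <= y ->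
  mu [set` Interval (BSide b1 x) (BSide b2 y)] = (y - x)%:E.
Proof.
move=> xy.
rewrite -[LHS]/(lebesgue_measure [set` Interval (BSide b1 x) (BSide b2 y)]).
rewrite lebesgue_measure_itv /= lte_fin.
by case: ltgtP xy => // -> _; rewrite subrr.
Qed.

Lemma completed_lebesgue_measure_itv_lty (b1 b2 : bool) x y : x <= y ->
  (mu [set` Interval (BSide b1 x) (BSide b2 y)] < +oo)%E.
Proof. by move=> xy; rewrite completed_lebesgue_measure_itv// ltry. Qed.

Lemma Rintegral_itv_cst r (b1 b2 : bool) x y : x <= y ->
  Rintegral mu [set` Interval (BSide b1 x) (BSide b2 y)] (fun=> r) = r * (y - x).
Proof.
move=> xy; rewrite Rintegral_cst; last exact: lebesgueR_measurable_itv.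
by congr (_ * _); exact: congr1 (completed_lebesgue_measure_itv b1 b2 xy).
Qed.

Lemma integrable_itv_cst r (b1 b2 : bool) x y : x <= y ->
  mu.-integrable [set` Interval (BSide b1 x) (BSide b2 y)] (EFin \o fun=> r).
Proof.
move=> xy; apply: measurable_bounded_integrable => //.
- exact: lebesgueR_measurable_itv.
- exact: completed_lebesgue_measure_itv_lty.
- by exists `|r|; split=> // M /ltW rM ? _.
Qed.

Lemma strategy_integrable sigma (i : interval R) : strategy sigma ->
  [set` i] `<=` `[0, 1] -> mu.-integrable [set` i] (EFin \o sigma).
Proof.
move=> [msig bsig] i01.
apply: (integrableS (E := (`[0, 1]%classic : set R) : set (lebesgueR R))) => //.
- exact: lebesgueR_measurable_itv.
- exact: lebesgueR_measurable_itv.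
apply: measurable_bounded_integrable => //.
- exact: lebesgueR_measurable_itv.
- exact: completed_lebesgue_measure_itv_lty.
exists 1; split=> // M M1 x /bsig /andP[s0 s1] /=.
by rewrite ger0_norm// (le_trans s1)// ltW.
Qed.

Lemma Rintegral_itv_bounds sigma (b1 b2 : bool) a b x y : strategy sigma ->
  0 <= x -> x <= y -> y <= 1 ->
  {in `[x, y], forall t, a <= sigma t <= b} ->
  a * (y - x) <= Rintegral mu [set` Interval (BSide b1 x) (BSide b2 y)] sigma
    <= b * (y - x).
Proof.
move=> ssig x0 xy y1 bnd; set i := Interval _ _.
have ixy : [set` i] `<=` `[x, y].
  by apply: subset_itv; rewrite bnd_simp; case: (b1); case: (b2).
have i01 : [set` i] `<=` `[0, 1].
  apply: (subset_trans ixy) => t /=; rewrite !in_itv /= => /andP[xt ty].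
  by rewrite (le_trans x0 xt) (le_trans ty y1).
have isig := strategy_integrable ssig i01.
rewrite -!(Rintegral_itv_cst _ b1 b2 xy); apply/andP; split.
- apply: (le_Rintegral _ (integrable_itv_cst a b1 b2 xy) isig) => //.
    exact: lebesgueR_measurable_itv.
  by move=> t /ixy /bnd /andP[].
- apply: (le_Rintegral _ isig (integrable_itv_cst b b1 b2 xy)) => //.
    exact: lebesgueR_measurable_itv.
  by move=> t /ixy /bnd /andP[].
Qed.

(** Later arguments use the integral through these mean value bounds: monotonicity, Lipschitz
    continuity and the derivative of the payoff gap all follow from them. *)
Lemma itv_integral_increment sigma a b x y : strategy sigma ->
  0 <= x -> x <= y -> y <= 1 -> {in `[x, y], forall t, a <= sigma t <= b} ->
  a * (y - x) <= itv_integral sigma 0 y - itv_integral sigma 0 x <= b * (y - x).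
Proof.
move=> ssig x0 xy y1 bnd.
suff -> : itv_integral sigma 0 y - itv_integral sigma 0 x =
    Rintegral mu `]x, y] sigma by exact: Rintegral_itv_bounds.
have yE : `[0, y]%classic = `[0, x] `|` `]x, y].
  by rewrite -itv_bndbnd_setU// !bnd_simp.
apply/eqP; rewrite subr_eq addrC /itv_integral yE; apply/eqP.
apply: Rintegral_setU.
- exact: lebesgueR_measurable_itv.
- exact: lebesgueR_measurable_itv.
- rewrite -yE; apply: strategy_integrable => // t /=; rewrite !in_itv /=.
  by move=> /andP[-> ty]; rewrite (le_trans ty y1).
- apply/disj_setPS => t [/=]; rewrite !in_itv /= => /andP[_ tx] /andP[xt _].
  by move: xt; rewrite ltNge tx.
Qed.

Lemma itv_integral00 sigma : strategy sigma -> itv_integral sigma 0 0 = 0.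
Proof.
move=> ssig; have /(_ 0 1) := @Rintegral_itv_bounds sigma true false _ _ 0 0 ssig.
rewrite subr0 !mulr0 => h; apply/eqP; rewrite eq_le andbC; apply: h => //.
move=> t; rewrite in_itv /= => /andP[t0 t1]; apply: ssig.2.
by rewrite in_itv /= t0 (le_trans t1).
Qed.

Lemma itv_integral_flee sigma x : strategy sigma -> x \in `[0, 1] ->
  itv_integral (fun t => 1 - sigma t) 0 x = x - itv_integral sigma 0 x.
Proof.
rewrite in_itv /= => ssig /andP[x0 x1]; rewrite /itv_integral RintegralB//.
- by rewrite Rintegral_itv_cst// subr0 mul1r.
- exact: lebesgueR_measurable_itv.
- exact: integrable_itv_cst.
- apply: strategy_integrable => // t /=; rewrite !in_itv /=.
  by move=> /andP[-> ty]; rewrite (le_trans ty x1).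
Qed.

Lemma continuous_strategy sigma : {within `[0, 1], continuous sigma} ->
  (forall x, x \in `[0, 1] -> 0 <= sigma x <= 1) -> strategy sigma.
Proof.
move=> csig bsig; split=> // _ Y mY; apply: borel_lebesgue_measurable.
exact: (subspace_continuous_measurable_fun (measurable_itv _) csig).
Qed.

End StrategyIntegrals.

(** * The payoff gap as an antiderivative of 1 - sigma *)

Section PayoffGap.
Context {R : realType}.
Implicit Types (B a b x y : R) (sigma : R -> R).

Definition flee_mass sigma : R := itv_integral (fun t => 1 - sigma t) 0 1.

Lemma payoff_gap_increment B sigma a b x y : strategy sigma ->
  0 <= x -> x <= y -> y <= 1 -> {in `[x, y], forall t, a <= sigma t <= b} ->
  (1 - b) * (y - x) <= payoff_gap B y sigma - payoff_gap B x sigma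
    <= (1 - a) * (y - x).
Proof.
move=> ssig x0 xy y1 /(itv_integral_increment ssig x0 xy y1).
by rewrite /payoff_gap /u_fight /u_flee => /andP[h1 h2]; apply/andP; split; lra.
Qed.

Lemma payoff_gap0 B sigma : strategy sigma ->
  payoff_gap B 0 sigma = - (B * flee_mass sigma).
Proof.
by move=> ssig; rewrite /payoff_gap /u_fight /u_flee itv_integral00// !add0r.
Qed.

Lemma payoff_gapE B sigma x : strategy sigma -> x \in `[0, 1] ->
  payoff_gap B x sigma =
    itv_integral (fun t => 1 - sigma t) 0 x - B * flee_mass sigma.
Proof.
move=> ssig x01; rewrite itv_integral_flee//.
by rewrite /payoff_gap /u_fight /u_flee -/(flee_mass sigma) opprD addrA.
Qed.

(** Together with [payoff_gap0] this locates the range of the gap: with m the flee mass it is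
    contained in [- B m, (1 - B) m]. For B <= 1/2 the reflection of its negative part lies inside
    its positive part. *)
Lemma payoff_gap1 B sigma : strategy sigma ->
  payoff_gap B 1 sigma = (1 - B) * flee_mass sigma.
Proof.
move=> ssig; rewrite payoff_gapE// ?in_itv/= ?ler01 ?lexx//.
by rewrite -/(flee_mass sigma) mulrBl mul1r.
Qed.

(** When the flee mass is positive, the c.d.f. is an increasing affine function of the gap: it is
    injective if the gap is, and equals B exactly where the gap vanishes. *)
Lemma flee_cdfE B sigma x : strategy sigma -> x \in `[0, 1] ->
  flee_cdf sigma x = (payoff_gap B x sigma + B * flee_mass sigma) / flee_mass sigma.
Proof. by move=> ssig x01; rewrite payoff_gapE// subrK. Qed.

End PayoffGap.

(** * Quantal response rules as functions of the payoff difference *)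

Section ChoiceRule.
Context {R : realType}.
Implicit Types (B x y : R) (sigma h : R -> R).

Definition choice_rule h : Prop :=
  [/\ continuous h, {homo h : x y / x < y}, forall d, 0 < h d < 1 &
      forall d, h (- d) = 1 - h d].

Definition generates h B sigma : Prop :=
  forall x, x \in `[0, 1] -> sigma x = h (payoff_gap B x sigma).

Lemma choice_rule_half h : choice_rule h -> h 0 = 2^-1.
Proof. by move=> [_ _ _ /(_ 0)]; rewrite oppr0 => ?; lra. Qed.

Lemma sym_QRE_of_rule (resp : (R * R -> R) -> Prop) B sigma h :
  choice_rule h -> generates h B sigma ->
  resp (fun v => h (v.1 - v.2)) -> sym_QRE resp B sigma.
Proof.
move=> hr hsig resph; have h0 := choice_rule_half hr.
case: (hr) => hc hm h01 hN.
exists (fun v => h (v.1 - v.2)); split; first exact: hsig.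
split; split=> //.
- move=> v; apply: (@continuous_comp _ _ _ (fun v : R * R => v.1 - v.2) h).
    by apply: continuousB; [exact: cvg_fst | exact: cvg_snd].
  exact: hc.
(* Payoff monotonicity compares h (v.1 - v.2) with h 0 = 1/2. *)
- move=> v; have [v12|v12|->] := ltgtP v.1 v.2; last first.
  + by rewrite subrr h0; split => // ?; lra.
  + have : h 0 < h (v.1 - v.2) by apply: hm; rewrite subr_gt0.
    by rewrite h0; split=> // _; lra.
  + have : h (v.1 - v.2) < h 0 by apply: hm; rewrite subr_lt0.
    by rewrite h0; split=> // ?; lra.
- by move=> v c /=; congr h; ring.
- by move=> a b /=; rewrite -hN opprB.
Qed.

Lemma strict_sym_QREP B sigma :
  sym_QRE strictly_responsive B sigma <->
  exists2 h, choice_rule h & generates h B sigma.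
Proof.
split=> [[Q [Qsig [[Q01 Qc [Q1 Q2] _] [QT QL]]]]|[h hr hsig]].
  (* Translation invariance determines Q by its values on the axis v.2 = 0: shifting (gap, 0) by the
     payoff of fleeing gives the payoff pair. *)
  exists (fun d => Q (d, 0)); last first.
    move=> x x01; rewrite Qsig// -[RHS](QT _ (u_flee B x sigma)) /=.
    by rewrite subrK add0r.
  split=> //.
  - move=> d; apply: continuous_comp (Qc (d, 0)).
    exact: (@cvg_pair _ _ _ (nbhs d) (nbhs d) (nbhs 0) _ _ _ id (fun=> 0)
      (@cvg_id _ _) (@cvg_cst _ _ _ _ _)).
  - by move=> d d' /Q1; exact.
  (* Shifting (- d, 0) by d gives (0, d), which label independence swaps to (d, 0). *)
  - by move=> d; rewrite -(QT _ d) /= addNr add0r QL.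
apply: (sym_QRE_of_rule hr hsig); case: hr => _ hm _ _.
by split=> a b b' ab /=; apply: hm; lra.
Qed.

(** The partial derivatives of h (v.1 - v.2) are h' and - h' at the difference, so responsiveness
    says that h' exists and is positive everywhere. *)
Lemma responsive_sym_QREP B sigma :
  sym_QRE responsive B sigma <->
  exists h, [/\ choice_rule h, generates h B sigma &
    forall d, derivable h d 1 /\ 0 < derive1 h d].
Proof.
split=> [[Q [Qsig [[Q01 Qc Qr _] [QT QL]]]]|[h [hr hsig hd]]].
  have dQ d : derivable (fun d => Q (d, 0)) d 1 /\ 0 < derive1 (fun d => Q (d, 0)) d.
    by case: (Qr (d, 0)).
  exists (fun d => Q (d, 0)); split=> //; last first.
    move=> x x01; rewrite Qsig// -[RHS](QT _ (u_flee B x sigma)) /=.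
    by rewrite subrK add0r.
  have cQ : continuous (fun d => Q (d, 0)).
    by move=> d; apply/differentiable_continuous/derivable1_diffP; case: (dQ d).
  split=> //.
  - move=> x y xy; apply: (@gtr0_derive1_incr _ (fun d => Q (d, 0)) x y) => //.
    + by move=> z _; case: (dQ z).
    + by move=> z _; case: (dQ z).
    + exact: continuous_subspaceT.
  - by move=> d; rewrite -(QT _ d) /= addNr add0r QL.
apply: (sym_QRE_of_rule hr hsig) => v /=.
have [dh h'0] := hd (v.1 - v.2).
have hD : is_derive (v.1 - v.2) 1 h (derive1 h (v.1 - v.2)).
  by rewrite derive1E; exact: derivableP.
have D1 : is_derive v.1 1 (fun t => h (t - v.2)) (derive1 h (v.1 - v.2)).
  have := @is_derive1_comp _ h (fun t => t - v.2) v.1 _ 1 hD.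
  by rewrite mulr1; apply; apply: is_derive_eq; rewrite subr0.
have D2 : is_derive v.2 1 (fun t => h (v.1 - t)) (- derive1 h (v.1 - v.2)).
  have := @is_derive1_comp _ h (fun t => v.1 - t) v.2 _ (-1) hD.
  by rewrite mulrN1; apply; apply: is_derive_eq; rewrite add0r mul1r.
split.
- by case: D1.
- by rewrite derive1E; case: D1 => _ ->.
- by case: D2.
- by rewrite derive1E; case: D2 => _ ->; rewrite oppr_lt0.
Qed.

End ChoiceRule.

(** * Derivatives relative to a subset of the line *)

Section Slope.
Context {R : realType}.
Implicit Types (A D : set R) (f g : R -> R) (a b x y l d e : R).

(** Difference quotients restricted to A give one-sided derivatives at the endpoints of a closed
    interval, as in [pos_derivative], and allow functions defined by pieces to be differentiated
    piece by piece. *)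
Definition has_slope A f x l : Prop :=
  (f y - f x) / (y - x) @[y --> within A x^'] --> l.

Local Instance within_dnbhs_filter A x : Filter (within A x^').
Proof. exact: within_filter. Qed.

Lemma cvg_within_dnbhsP A f x l :
  f y @[y --> within A x^'] --> l <->
  forall e, 0 < e -> exists2 d, 0 < d &
    forall y, A y -> y != x -> `|y - x| < d -> `|f y - l| < e.
Proof.
split=> [/cvgrPdist_lt fl e e0|fl].
  have /nbhs_ballP[d /= d0 xd] : nbhs x (fun y => y != x -> A y -> `|l - f y| < e).
    exact: fl.
  exists d => // y Ay yx yd; rewrite distrC.
  by apply: xd => //; rewrite -ball_normE /= distrC.
apply/cvgrPdist_lt => e /fl [d d0 xd].
have : nbhs x (fun y => y != x -> A y -> `|l - f y| < e).
  apply/nbhs_ballP; exists d => //= y; rewrite -ball_normE /= => xyd yx Ay.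
  by rewrite distrC; apply: xd => //; rewrite distrC.
exact.
Qed.

Lemma eq_cvg_within_dnbhs A f g x l : (forall y, A y -> y != x -> f y = g y) ->
  f y @[y --> within A x^'] --> l -> g y @[y --> within A x^'] --> l.
Proof.
move=> fg /cvg_within_dnbhsP fl; apply/cvg_within_dnbhsP => e /fl [d d0 h].
by exists d => // y Ay yx; rewrite -fg//; exact: h.
Qed.

Lemma continuous_withinP A f :
  {within A, continuous f} <->
  forall x, A x -> forall e, 0 < e -> exists2 d, 0 < d &
    forall y, A y -> `|y - x| < d -> `|f y - f x| < e.
Proof.
rewrite subspace_continuousP; split=> fc x Ax.
  move=> e e0; have /cvgrPdist_lt/(_ _ e0) fx := fc x Ax.
  have /nbhs_ballP[d /= d0 xd] : nbhs x (fun y => A y -> `|f x - f y| < e).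
    exact: fx.
  exists d => // y Ay yd; rewrite distrC.
  by apply: xd => //; rewrite -ball_normE /= distrC.
apply/cvgrPdist_lt => e /(fc x Ax) [d d0 xd].
have : nbhs x (fun y => A y -> `|f x - f y| < e).
  apply/nbhs_ballP; exists d => //= y; rewrite -ball_normE /= => xyd Ay.
  by rewrite distrC; apply: xd => //; rewrite distrC.
exact.
Qed.

Lemma continuous_within_comp A D f g : {within D, continuous f} ->
  {within A, continuous g} -> (forall x, A x -> D (g x)) ->
  {within A, continuous (f \o g)}.
Proof.
move=> /continuous_withinP fc /continuous_withinP gc AD.
apply/continuous_withinP => x Ax e /(fc _ (AD _ Ax)) [d /(gc _ Ax) [d' d'0 gd] fd].
by exists d' => // y Ay yx; apply: fd; [exact: AD | exact: gd].
Qed.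

Lemma continuous_within_dnbhs A f x : {within A, continuous f} -> A x ->
  f y @[y --> within A x^'] --> f x.
Proof.
move=> /continuous_withinP fc Ax; apply/cvg_within_dnbhsP => e /(fc _ Ax) [d d0 fd].
by exists d => // y Ay _; exact: fd.
Qed.

Lemma lipschitz_continuous_within A f (k : R) :
  {in A &, forall x y, `|f x - f y| <= k * `|x - y|} ->
  {within A, continuous f}.
Proof.
move=> fk; apply/continuous_withinP => x Ax e e0.
(* The divisor [|k| + 1] is positive whatever the sign of k. *)
have k1 : 0 < `|k| + 1 by rewrite ltr_wpDl.
exists (e / (`|k| + 1)); first by rewrite divr_gt0.
move=> y Ay; rewrite ltr_pdivlMr// => yx.
apply: (le_lt_trans (fk y x _ _)); rewrite ?inE//.
apply: le_lt_trans yx; rewrite mulrC ler_wpM2l//.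
by rewrite (le_trans (ler_norm k))// lerDl.
Qed.

Lemma has_slope_within_cvg A f x l : has_slope A f x l ->
  f y @[y --> within A x^'] --> f x.
Proof.
move=> fl.
have id0 : y - x @[y --> within A x^'] --> 0.
  apply/cvg_within_dnbhsP => e e0; exists e => // y _ _.
  by rewrite subr0.
have : (f y - f x) / (y - x) * (y - x) + f x @[y --> within A x^'] --> l * 0 + f x.
  by apply: cvgD; [exact: cvgM | exact: cvg_cst].
rewrite mulr0 add0r.
apply: eq_cvg_within_dnbhs => y _ yx /=.
by rewrite -mulrA mulVf ?mulr1 ?subrK// subr_eq0.
Qed.

Lemma cvg_within_dnbhs_comp A D g x :
  g y @[y --> within A x^'] --> g x -> (forall y, A y -> D (g y)) ->
  (forall y, A y -> y != x -> g y != g x) ->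
  g y @[y --> within A x^'] --> within D (g x)^'.
Proof.
move=> gx AD gneq P; rewrite /within /= => /gx.
have AP (Q : R -> Prop) : (\forall y \near within A x^', Q y) ->
    \forall y \near x, y != x -> A y -> Q y by exact.
move=> /AP nP.
suff : \forall y \near x, y != x -> A y -> P (g y) by exact.
apply: filterS nP => y h yx Ay; apply: (h yx Ay); first exact: gneq.
exact: AD.
Qed.

(** Chain rule. Since g y differs from g x for y in A other than x, the quotient of the composite
    factors without a division by zero. *)
Lemma has_slope_comp A D f g x l k :
  has_slope A g x k -> has_slope D f (g x) l -> (forall y, A y -> D (g y)) ->
  (forall y, A y -> y != x -> g y != g x) ->
  has_slope A (f \o g) x (l * k).
Proof.
move=> gk fl AD gneq.
have gx := cvg_within_dnbhs_comp (has_slope_within_cvg gk) AD gneq.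
have : (f (g y) - f (g x)) / (g y - g x) * ((g y - g x) / (y - x))
    @[y --> within A x^'] --> l * k
  by apply: cvgM => //; exact: (cvg_comp _ _ gx fl).
apply: eq_cvg_within_dnbhs => y Ay yx /=.
by rewrite mulrA divfK// subr_eq0; exact: gneq.
Qed.

(** The quotient of the inverse f at y is the reciprocal of the quotient of g at f y, and f y tends
    to f x. *)
Lemma has_slope_inverse A D g f x l :
  has_slope D g (f x) l -> l != 0 -> f y @[y --> within A x^'] --> f x ->
  (forall y, A y -> D (f y)) -> (forall y, A y -> g (f y) = y) -> A x ->
  has_slope A f x l^-1.
Proof.
move=> gl l0 fx AD gfK Ax.
have fneq y : A y -> y != x -> f y != f x.
  by move=> Ay; apply: contra_neq => /(congr1 g); rewrite !gfK.
have : ((g (f y) - g (f x)) / (f y - f x))^-1 @[y --> within A x^'] --> l^-1.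
  by apply: cvgV => //; exact: (cvg_comp _ _ (cvg_within_dnbhs_comp fx AD fneq) gl).
by apply: eq_cvg_within_dnbhs => y Ay yx /=; rewrite !gfK// invf_div.
Qed.

Lemma has_slopeU A D f x l : has_slope A f x l -> has_slope D f x l ->
  has_slope (A `|` D) f x l.
Proof.
move=> /cvg_within_dnbhsP fA /cvg_within_dnbhsP fD.
apply/cvg_within_dnbhsP => e e0.
have [d1 d10 h1] := fA _ e0; have [d2 d20 h2] := fD _ e0.
exists (Num.min d1 d2); first by rewrite lt_min d10.
by move=> y [Ay|Dy] yx; rewrite lt_min => /andP[? ?]; [exact: h1 | exact: h2].
Qed.

Lemma has_slope_eq A f g x l : {in A, f =1 g} -> f x = g x ->
  has_slope A f x l -> has_slope A g x l.
Proof.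
move=> fg fgx; by apply: eq_cvg_within_dnbhs => y Ay yx; rewrite fgx fg// inE.
Qed.

Lemma has_slopeS A D f x l : D `<=` A -> has_slope A f x l -> has_slope D f x l.
Proof.
move=> DA /cvg_within_dnbhsP fA; apply/cvg_within_dnbhsP => e /fA [d d0 h].
by exists d => // y /DA; exact: h.
Qed.

(* Away from A the limit in [has_slope] is vacuous. *)
Lemma has_slope_far A f x l d : 0 < d -> (forall y, A y -> d <= `|y - x|) ->
  has_slope A f x l.
Proof.
move=> d0 Ad; apply/cvg_within_dnbhsP => e e0; exists d => // y /Ad + _.
by rewrite leNgt => /negP.
Qed.

(** Point reflection of a graph through (0, 1/2) preserves slopes. *)
Lemma has_slopeN A f x l : has_slope A f (- x) l ->
  has_slope [set y | A (- y)] (fun y => 1 - f (- y)) x l.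
Proof.
move=> /cvg_within_dnbhsP fA; apply/cvg_within_dnbhsP => e /fA [d d0 h].
exists d => // y /= Ay yx yd; have := h _ Ay.
rewrite eqr_opp yx -opprD normrN => /(_ isT yd).
congr (`|_ - _| < _); rewrite invrN mulrN -mulNr.
by congr (_ / _); lra.
Qed.

Lemma is_derive_slope f x l : is_derive x 1 f l <-> has_slope setT f x l.
Proof.
rewrite /has_slope; split=> [[df <-]|fl].
  apply/cvg_within_dnbhsP => e e0.
  have /cvgrPdist_lt/(_ _ e0) :
      h^-1 *: (f (h *: 1 + x) - f x) @[h --> (0 : R)^'] --> 'D_1 f x.
    exact: df.
  move=> /= dfe.
  have /nbhs_ballP[d /= d0 xd] : nbhs (0 : R)
      (fun h : R => h != 0 -> `|'D_1 f x - h^-1 *: (f (h *: 1 + x) - f x)| < e).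
    exact: dfe.
  exists d => // y _ yx yd; rewrite distrC.
  have := xd (y - x); rewrite -ball_normE /= sub0r normrN subr_eq0 => /(_ yd yx).
  by rewrite /GRing.scale /= mulr1 subrK mulrC.
have fd : h^-1 *: (f (h *: 1 + x) - f x) @[h --> (0 : R)^'] --> l.
  apply/cvgrPdist_lt => e e0.
  move/cvg_within_dnbhsP : fl => /(_ e e0) [d d0 xd].
  suff : nbhs (0 : R)
      (fun h : R => h != 0 -> `|l - h^-1 *: (f (h *: 1 + x) - f x)| < e) by exact.
  apply/nbhs_ballP; exists d => //= h; rewrite -ball_normE /= sub0r normrN => hd h0.
  have := xd (h + x); rewrite addrK -subr_eq0 addrK => /(_ I h0 hd).
  by rewrite distrC /GRing.scale /= mulr1 mulrC.
by split; [apply/cvg_ex; exists l | exact/cvg_lim].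
Qed.

(** The complement of [a, b] stays at a positive distance from an interior point, so it adds no
    condition to the limit. *)
Lemma has_slope_is_derive a b f x l : a < x < b -> has_slope `[a, b] f x l ->
  is_derive x 1 f l.
Proof.
move=> /andP[ax xb] fl; apply/is_derive_slope; rewrite -(setUv `[a, b]%classic).
apply: has_slopeU => //.
apply: (@has_slope_far _ _ _ _ (Num.min (x - a) (b - x))).
  by rewrite lt_min !subr_gt0 ax.
move=> y yN; rewrite ge_min; apply/orP.
have [ya|ay] := ltP y a.
  by left; rewrite ltr0_norm; lra.
right; have [yb|yb] := leP y b; last by rewrite gtr0_norm; lra.
by exfalso; apply: yN; rewrite /= in_itv /= ay yb.
Qed.

End Slope.

(** * Regularity of the payoff gap *)

Section StrategyGap.
Context {R : realType}.
Variables (B : R) (sigma : R -> R).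
Hypothesis ssig : strategy sigma.
Implicit Types x y d : R.

Local Notation gap x := (payoff_gap B x sigma).

Lemma payoff_gap_lipschitz x y : 0 <= x -> x <= y -> y <= 1 ->
  0 <= gap y - gap x <= y - x.
Proof.
move=> x0 xy y1.
have /(_ 0 1) := payoff_gap_increment B ssig x0 xy y1.
rewrite subrr mul0r subr0 mul1r; apply=> t; rewrite in_itv /= => /andP[xt ty].
by apply: ssig.2; rewrite in_itv /= (le_trans x0 xt) (le_trans ty y1).
Qed.

Lemma payoff_gap_nondecreasing :
  {in `[0, 1] &, {homo (fun x => gap x) : x y / x <= y}}.
Proof.
move=> x y; rewrite !in_itv /= => /andP[x0 _] /andP[_ y1] xy.
by have /andP[] := payoff_gap_lipschitz x0 xy y1; rewrite subr_ge0.
Qed.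

Lemma payoff_gap_continuous : {within `[0, 1], continuous (fun x => gap x)}.
Proof.
apply: (@lipschitz_continuous_within _ _ _ 1) => x y.
rewrite !inE /= !in_itv /= mul1r => /andP[x0 x1] /andP[y0 y1].
wlog xy : x y x0 x1 y0 y1 / x <= y.
  by move=> w; have [/w|/ltW /w] := leP x y; last rewrite distrC (distrC y); exact.
have /andP[g0 gxy] := payoff_gap_lipschitz x0 xy y1.
by rewrite distrC (ger0_norm g0) distrC ger0_norm// subr_ge0.
Qed.

(** Fundamental theorem of calculus, one-sided at 0 and 1. Near x, sigma stays within e / 2 of sigma
    x, which bounds every difference quotient; the half turns the weak bounds on increments into a
    strict one. *)
Lemma payoff_gap_slope : {within `[0, 1], continuous sigma} ->
  {in `[0, 1], forall x, has_slope `[0, 1] (fun x => gap x) x (1 - sigma x)}.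
Proof.
move=> /continuous_withinP csig x x01; apply/cvg_within_dnbhsP => e e0.
have e20 : 0 < e / 2 by rewrite divr_gt0.
have [d d0 sigd] := csig x x01 _ e20; exists d => // y y01 yx yd.
(* Stating the estimate for an ordered pair u < v near x serves both y < x and x < y. *)
have inc u v : u \in `[0, 1] -> v \in `[0, 1] -> u < v ->
    (forall t, t \in `[u, v] -> `|t - x| < d) ->
    `|(gap v - gap u) / (v - u) - (1 - sigma x)| < e.
  rewrite !in_itv /= => /andP[u0 u1] /andP[v0 v1] uv uvd.
  have /(_ (sigma x - e / 2) (sigma x + e / 2)) :=
    payoff_gap_increment B ssig u0 (ltW uv) v1.
  move=> /(_ _)/andP[|].
    move=> t tuv; have := sigd t _ (uvd _ tuv); rewrite /= in_itv /=.
    move: tuv; rewrite in_itv /= => /andP[ut tv].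
    rewrite (le_trans u0 ut) (le_trans tv v1) => /(_ isT).
    by rewrite ltr_norml => /andP[? ?]; apply/andP; split; lra.
  have vu0 : 0 < v - u by rewrite subr_gt0.
  rewrite -ler_pdivlMr// => h1; rewrite -ler_pdivrMr// => h2.
  by rewrite ltr_norml; apply/andP; split; lra.
move: yd; rewrite ltr_norml => /andP[yd1 yd2].
move: yx; rewrite neq_lt => /orP[yx|xy].
  rewrite -(opprB x y) -(opprB (gap x)) invrN mulrNN; apply: inc => // t.
  rewrite in_itv /= => /andP[? ?].
  by rewrite ltr_norml; apply/andP; split; lra.
apply: inc => // t; rewrite in_itv /= => /andP[? ?].
by rewrite ltr_norml; apply/andP; split; lra.
Qed.

End StrategyGap.

(** * The payoff gap of an increasing interior strategy and its zero *)

Section IncreasingStrategy.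
Context {R : realType}.
Variables (B : R) (sigma : R -> R).
Hypotheses (ssig : strategy sigma) (B_gt0 : 0 < B) (B_lt1 : B < 1).
Hypothesis sig_incr : {in `[0, 1] &, {homo sigma : x y / x < y}}.
Hypothesis sig_int : forall x, x \in `[0, 1] -> 0 < sigma x < 1.
Implicit Types x y d : R.

Local Notation gap x := (payoff_gap B x sigma).
Local Notation mass := (flee_mass sigma).

Let in01_0 : (0 : R) \in `[0, 1].
Proof. by rewrite in_itv /= lexx ler01. Qed.

Let in01_1 : (1 : R) \in `[0, 1].
Proof. by rewrite in_itv /= lexx ler01. Qed.

Let sig_le : {in `[0, 1] &, {homo sigma : x y / x <= y}}.
Proof.
move=> x y xI yI; rewrite le_eqVlt => /predU1P[->//|xy].
exact/ltW/sig_incr.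
Qed.

(** This is concavity of the gap in integrated form: its slope 1 - sigma decreases. *)
Lemma payoff_gap_increment_mono x y : x \in `[0, 1] -> y \in `[0, 1] -> x <= y ->
  (1 - sigma y) * (y - x) <= gap y - gap x <= (1 - sigma x) * (y - x).
Proof.
move=> xI yI xy; have := xI; have := yI.
rewrite !in_itv /= => /andP[y0 y1] /andP[x0 x1].
apply: payoff_gap_increment => // t; rewrite in_itv /= => /andP[xt ty].
have tI : t \in `[0, 1] by rewrite in_itv /= (le_trans x0 xt) (le_trans ty y1).
by rewrite !sig_le.
Qed.

(** The least slope of the gap is 1 - sigma 1. This bound makes the gap strictly increasing and its
    inverse Lipschitz. *)
Lemma payoff_gap_expansive x y : x \in `[0, 1] -> y \in `[0, 1] -> x <= y ->
  (1 - sigma 1) * (y - x) <= gap y - gap x.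
Proof.
move=> xI yI xy; have /andP[+ _] := payoff_gap_increment_mono xI yI xy.
apply: le_trans; apply: ler_wpM2r; first by rewrite subr_ge0.
by rewrite lerD2l lerN2 sig_le//; move: yI; rewrite in_itv /= => /andP[].
Qed.

Lemma payoff_gap_increasing :
  {in `[0, 1] &, {homo (fun x => gap x) : x y / x < y}}.
Proof.
move=> x y xI yI xy; rewrite -subr_gt0.
apply: lt_le_trans (payoff_gap_expansive xI yI (ltW xy)).
by rewrite mulr_gt0 ?subr_gt0//; have /andP[] := sig_int in01_1.
Qed.

Lemma payoff_gap_lt : {in `[0, 1] &, {mono (fun x => gap x) : x y / x < y}}.
Proof. exact/leW_mono_in/le_mono_in/payoff_gap_increasing. Qed.

Lemma payoff_gap_inj : {in `[0, 1] &, injective (fun x => gap x)}.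
Proof. exact/inc_inj_in/le_mono_in/payoff_gap_increasing. Qed.

Lemma flee_mass_gt0 : 0 < mass.
Proof.
rewrite /flee_mass itv_integral_flee// subr_gt0.
have /(_ 0 (sigma 1)) := itv_integral_increment ssig (lexx 0) ler01 (lexx 1).
rewrite itv_integral00// !subr0 !mulr1 => /(_ _)/andP[|_ s1].
  move=> t tI; have /andP[/ltW -> _] := sig_int tI; rewrite sig_le//.
  by move: tI; rewrite in_itv /= => /andP[].
by apply: le_lt_trans s1 _; have /andP[] := sig_int in01_1.
Qed.

Lemma payoff_gap_onto d : gap 0 <= d <= gap 1 ->
  exists2 x, x \in `[0, 1] & gap x = d.
Proof.
move=> d01; apply: (IVT ler01 (payoff_gap_continuous ssig)).
have g01 : gap 0 <= gap 1 by exact/ltW/payoff_gap_increasing.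
by rewrite (min_idPl g01) (max_idPr g01).
Qed.

(** The gap increases continuously from - B m to (1 - B) m, with m the flee mass, so it has a single
    zero. The chord between these endpoints vanishes at B, and a strictly concave function lies
    above its chord, so the zero comes before B. *)
Lemma indifferent_type : exists x,
  [/\ x \in `]0, B[, unique (indifferent B sigma) x & x = flee_cdf_inv sigma B].
Proof.
have m0 := flee_mass_gt0.
have Bm0 : 0 < B * mass by rewrite mulr_gt0.
have B1m0 : 0 < (1 - B) * mass by rewrite mulr_gt0// subr_gt0.
have g0 := payoff_gap0 B ssig; have g1 := payoff_gap1 B ssig.
have [x xI gx] : exists2 x, x \in `[0, 1] & gap x = 0.
  by apply: payoff_gap_onto; rewrite g0 g1 oppr_le0 !ltW.
have x0 : 0 < x.
  by rewrite -payoff_gap_lt// gx g0 oppr_lt0.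
have x1 : x < 1.
  by rewrite -payoff_gap_lt// gx g1.
exists x; split.
- rewrite in_itv /= x0 /= ltNge; apply/negP => Bx.
  (* Cutting [0, x] at its midpoint makes the slope bound there strict: (1 - sigma x) x < B m. On
     [x, 1] the slope is at most 1 - sigma x, and B <= x then gives m <= 1 - sigma x. Hence B m <=
     (1 - sigma x) x, a contradiction. *)
  have [z zE] : exists z, z + z = x by exists (x / 2); lra.
  have zI : z \in `[0, 1] by rewrite in_itv /=; apply/andP; split; lra.
  have zx : z < x by lra.
  have z0 : 0 < z by lra.
  have /andP[h1 _] := payoff_gap_increment_mono in01_0 zI (ltW z0).
  have /andP[h2 _] := payoff_gap_increment_mono zI xI (ltW zx).
  have /andP[_ h3] := payoff_gap_increment_mono xI in01_1 (ltW x1).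
  have szx := sig_incr zI xI zx.
  have /andP[_ sx1] := sig_int xI.
  have xz : x - z = z by lra.
  move: h1 h2 h3; rewrite g0 g1 gx xz subr0 => h1 h2 h3.
  have h4 : (1 - sigma x) * z < (1 - sigma z) * z by rewrite ltr_pM2r//; lra.
  have h5 : (1 - sigma x) * x < B * mass.
    by rewrite -[X in _ * X]zE mulrDr; lra.
  have h6 : (1 - sigma x) * (1 - x) <= (1 - sigma x) * (1 - B).
    by rewrite ler_wpM2l//; lra.
  have h7 : (1 - sigma x) * B <= (1 - sigma x) * x.
    by rewrite ler_wpM2l//; lra.
  have : mass <= 1 - sigma x.
    by rewrite -(ler_pM2l (_ : 0 < 1 - B)) ?subr_gt0//; lra.
  rewrite -(ler_pM2l B_gt0) => h8; lra.
- split; first by split.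
  by move=> y [yI gy]; apply: payoff_gap_inj => //; rewrite gx gy.
- have cdfx : flee_cdf sigma x = B.
    by rewrite (flee_cdfE B)// gx add0r mulfK// gt_eqF.
  rewrite /flee_cdf_inv -[in RHS]cdfx pinvKV ?inE//.
  move=> u v; rewrite !inE /= => uI vI; rewrite !(flee_cdfE B)//.
  move=> /(mulIf (invr_neq0 (lt0r_neq0 m0))) /addIr.
  exact: payoff_gap_inj.
Qed.

End IncreasingStrategy.

(** * From a choice rule to the shape conditions *)

Section RuleToShape.
Context {R : realType}.
Variables (B : R) (sigma h : R -> R).
Hypotheses (ssig : strategy sigma) (B_gt0 : 0 < B) (B_lt1 : B < 1).
Hypotheses (hr : choice_rule h) (hsig : generates h B sigma).
Implicit Types x y : R.

Let in01_1 : (1 : R) \in `[0, 1].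
Proof. by rewrite in_itv /= lexx ler01. Qed.

Let sig_int x : x \in `[0, 1] -> 0 < sigma x < 1.
Proof. by move=> /hsig ->; case: hr. Qed.

(** The argument must not assume that the gap is strictly increasing. The gap is at least
    nondecreasing, so sigma = h o gap is bounded by sigma 1 < 1; then the gap has slope at least 1 -
    sigma 1 > 0, and strictness passes to sigma. *)
Let sig_incr : {in `[0, 1] &, {homo sigma : x y / x < y}}.
Proof.
case: hr => _ hm _ _ x y xI yI xy; rewrite !hsig//; apply: (hm).
have := xI; have := yI; rewrite !in_itv /= => /andP[y0 y1] /andP[x0 x1].
have hle a b : a <= b -> h a <= h b.
  by rewrite le_eqVlt => /predU1P[->//|/hm /ltW].
have /andP[+ _] : (1 - sigma 1) * (y - x) <=
    payoff_gap B y sigma - payoff_gap B x sigma <= (1 - 0) * (y - x).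
  apply: payoff_gap_increment => //; first exact: ltW.
  move=> t; rewrite in_itv /= => /andP[xt ty].
  have tI : t \in `[0, 1] by rewrite in_itv /= (le_trans x0 xt) (le_trans ty y1).
  have /andP[/ltW -> _] := sig_int tI; rewrite /= !hsig//; apply: hle.
  by apply: payoff_gap_nondecreasing => //; rewrite (le_trans ty y1).
rewrite -subr_gt0; apply: lt_le_trans.
by rewrite mulr_gt0 ?subr_gt0//; have /andP[] := sig_int in01_1.
Qed.

Lemma generated_strategy_continuous : {within `[0, 1], continuous sigma}.
Proof.
apply: (@subspace_eq_continuous _ _ _ (h \o (fun x => payoff_gap B x sigma))).
  by move=> x; rewrite inE /= => xI; exact/esym/hsig.
case: hr => hc _ _ _; apply/subspace_continuousP => x xI.
have /subspace_continuousP/(_ x xI) gx := payoff_gap_continuous (B := B) ssig.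
exact: (cvg_comp _ _ gx (hc _)).
Qed.

Lemma generated_qre_shape : qre_shape B sigma.
Proof.
case: (hr) => hc hm h01 hN.
have [x [xB xu xE]] := indifferent_type ssig B_gt0 B_lt1 sig_incr sig_int.
split.
- by split; [exact: generated_strategy_continuous | exact: sig_incr].
- exact: sig_int.
- exists x; split=> //; case: xu => [[xI gx] _].
  by rewrite hsig// gx choice_rule_half.
- move=> y z yI zI; rewrite !hsig// -hN; split=> [|->//].
  exact/inc_inj/le_mono.
Qed.

Lemma generated_pos_derivative :
  (forall d, derivable h d 1 /\ 0 < derive1 h d) -> pos_derivative sigma.
Proof.
move=> hd x xI; have [dh h'0] := hd (payoff_gap B x sigma).
exists (derive1 h (payoff_gap B x sigma) * (1 - sigma x)).
  by rewrite mulr_gt0// subr_gt0; case/andP: (sig_int xI).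
apply: (@has_slope_eq _ _ (h \o (fun x => payoff_gap B x sigma))).
- by move=> y; rewrite inE /= => yI; rewrite hsig.
- by rewrite hsig.
apply: (@has_slope_comp _ _ setT) => //.
- by apply: payoff_gap_slope => //; exact: generated_strategy_continuous.
- apply/is_derive_slope; rewrite derive1E; exact: derivableP.
- move=> y yI; apply: contra_neq => /(payoff_gap_inj ssig sig_incr sig_int).
  exact.
Qed.

End RuleToShape.

(** * Reflection of a rule given on the nonnegative half-line *)

Section OddExtension.
Context {R : realType}.
Variable p : R -> R.
Hypotheses (p0 : p 0 = 2^-1) (p_lt1 : forall d, 0 <= d -> p d < 1)
  (p_incr : {in `[0, +oo[ &, {homo p : x y / x < y}})
  (p_cont : {within `[0, +oo[, continuous p}).
Implicit Types d x y : R.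

(** The graph is symmetric about the point (0, 1/2); the two branches meet at 0 because p 0 =
    1/2. *)
Definition odd_extension d : R := if 0 <= d then p d else 1 - p (- d).

Local Notation h := odd_extension.

Lemma odd_extensionN d : h (- d) = 1 - h d.
Proof.
rewrite /h oppr_ge0; have [d0|d0|->] := ltgtP d 0; rewrite ?opprK ?oppr0 ?p0 //.
  by rewrite subKr.
lra.
Qed.

Let p_ge x : 0 <= x -> 2^-1 <= p x.
Proof.
rewrite le_eqVlt => /predU1P[<-|x0]; first by rewrite p0.
by rewrite -p0 ltW// p_incr// in_itv /= ?lexx// ltW.
Qed.

Lemma odd_extension_increasing : {homo h : x y / x < y}.
Proof.
move=> x y xy; rewrite /h; have [x0|x0] := leP 0 x.
  have y0 : 0 <= y by exact: le_trans (ltW xy).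
  by rewrite y0 p_incr// in_itv /= ?x0 ?y0.
have px : 2^-1 < p (- x).
  by rewrite -p0 p_incr// ?in_itv /= ?lexx// ?oppr_ge0 ?oppr_gt0// ltW.
case: (leP 0 y) => y0; first by have := p_ge y0; lra.
have : p (- y) < p (- x).
  by apply: p_incr; rewrite ?in_itv /= ?andbT; lra.
lra.
Qed.

Lemma odd_extension_bounds d : 0 < h d < 1.
Proof.
rewrite /h; case: (leP 0 d) => d0.
  by have := p_ge d0; have := p_lt1 d0 => ? ?; apply/andP; split; lra.
have d0' : 0 <= - d by lra.
by have := p_ge d0'; have := p_lt1 d0' => ? ?; apply/andP; split; lra.
Qed.

Lemma half_lines : `[0, +oo[%classic `|` `]-oo, 0]%classic = [set: R].
Proof.
apply/seteqP; split=> // d _ /=; rewrite !in_itv /= andbT.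
by apply/orP; exact: le_total.
Qed.

Let h_neg d : d <= 0 -> h d = 1 - p (- d).
Proof.
rewrite le_eqVlt => /predU1P[->|d0]; first by rewrite /h lexx oppr0 p0; lra.
by rewrite /h leNgt d0.
Qed.

Lemma odd_extension_continuous : continuous h.
Proof.
suff : {within [set: R], continuous h}.
  rewrite continuous_open_subspace; last exact: openT.
  by move=> hc x; apply: hc; rewrite inE.
rewrite -half_lines; apply: withinU_continuous.
- exact: interval_closed.
- exact: interval_closed.
- apply: subspace_eq_continuous p_cont => d.
  by rewrite inE /= in_itv /= andbT /from_subspace /h => ->.
- apply/continuous_withinP => x; rewrite /= in_itv /= => x0 e e0.
  have [|d d0 xd] := (continuous_withinP _ _).1 p_cont (- x) _ e e0.
    by rewrite /= in_itv /= andbT oppr_ge0.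
  exists d => // y; rewrite /= in_itv /= => y0 yx; rewrite !h_neg//.
  have := xd (- y); rewrite /= in_itv /= andbT oppr_ge0 => /(_ y0).
  rewrite -opprD normrN => /(_ yx).
  by rewrite opprD addrACA subrr add0r -opprD normrN.
Qed.

Lemma odd_extension_rule : choice_rule h.
Proof.
split; [exact: odd_extension_continuous | exact: odd_extension_increasing |
  exact: odd_extension_bounds | exact: odd_extensionN].
Qed.

(** At 0 the reflected branch has the same slope as p from the right, so no kink appears. Positive
    points are away from the reflected branch, and negative points follow by symmetry. *)
Lemma odd_extension_derivable :
  (forall d, 0 <= d -> exists2 l, 0 < l & has_slope `[0, +oo[ p d l) ->
  forall d, derivable h d 1 /\ 0 < derive1 h d.
Proof.
move=> pd d.
have pos x : 0 <= x -> exists2 l, 0 < l & has_slope setT h x l.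
  move=> x0; have [l l0 pl] := pd x x0; exists l => //.
  have hp : {in `[0, +oo[%classic, p =1 h}.
    by move=> y; rewrite inE /= in_itv /= andbT /h => ->.
  rewrite -half_lines; apply: has_slopeU.
    by apply: has_slope_eq pl; rewrite ?hp// inE /= in_itv /= x0.
  move: x0; rewrite le_eqVlt => /predU1P[x0|x0]; last first.
    apply: (@has_slope_far _ _ _ _ _ x) => // y; rewrite /= in_itv /= => y0.
    by rewrite ler0_norm; lra.
  have := @has_slopeN _ `[0, +oo[ p x l; rewrite -x0 oppr0.
  rewrite -x0 in pl => /(_ pl).
  have -> : [set y | `[0, +oo[%classic (- y)] = `]-oo, 0]%classic :> set R.
    by apply/seteqP; split=> y /=; rewrite !in_itv /= andbT oppr_ge0.
  apply: has_slope_eq; last by rewrite h_neg.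
  by move=> y; rewrite inE /= in_itv /= => /h_neg ->.
have [l l0 hl] : exists2 l, 0 < l & has_slope setT h d l.
  have [/pos//|d0] := leP 0 d.
  have [|l l0 hl] := pos (- d); first by lra.
  exists l => //; have := has_slopeN hl.
  rewrite (_ : [set y | _] = setT)//.
  by apply: has_slope_eq; [move=> y _|]; rewrite odd_extensionN; lra.
have dh := (is_derive_slope h d l).2 hl.
by split; [case: dh | rewrite derive1E; case: dh => _ ->].
Qed.

End OddExtension.

(** * From the shape conditions to a choice rule *)

Section ShapeToRule.
Context {R : realType}.
Variables (B : R) (sigma : R -> R).
Hypotheses (ssig : strategy sigma) (B_gt0 : 0 < B) (B_le : B <= 2^-1).
Hypothesis shape : qre_shape B sigma.
Variable k : R.
Hypothesis k_gt0 : 0 < k.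
Implicit Types d x y : R.

Local Notation gap x := (payoff_gap B x sigma).
Local Notation s1 := (sigma 1).

Let in01_0 : (0 : R) \in `[0, 1].
Proof. by rewrite in_itv /= lexx ler01. Qed.

Let in01_1 : (1 : R) \in `[0, 1].
Proof. by rewrite in_itv /= lexx ler01. Qed.

Let B_lt1 : B < 1.
Proof. by move: B_le => ?; lra. Qed.

Let sig_cont : {within `[0, 1], continuous sigma}.
Proof. by case: shape => [[]]. Qed.

Let sig_incr : {in `[0, 1] &, {homo sigma : x y / x < y}}.
Proof. by case: shape => [[]]. Qed.

Let sig_int x : x \in `[0, 1] -> 0 < sigma x < 1.
Proof. by case: shape => [_ + _ _]; exact. Qed.

Let gap_lt : {in `[0, 1] &, {mono (fun x => gap x) : x y / x < y}}.
Proof. exact: payoff_gap_lt. Qed.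

Let gap_inj : {in `[0, 1] &, injective (fun x => gap x)}.
Proof. exact: payoff_gap_inj. Qed.

Let s1_lt1 : 0 < 1 - s1.
Proof. by rewrite subr_gt0; case/andP: (sig_int in01_1). Qed.

Let mass_gt0 : 0 < flee_mass sigma.
Proof. exact: flee_mass_gt0. Qed.

Let gap0_lt0 : gap 0 < 0.
Proof. by rewrite payoff_gap0// oppr_lt0 mulr_gt0. Qed.

Let gap1_gt0 : 0 < gap 1.
Proof. by rewrite payoff_gap1// mulr_gt0// subr_gt0. Qed.

Let gap_bounds x : x \in `[0, 1] -> gap 0 <= gap x <= gap 1.
Proof.
move=> xI; have := xI; rewrite in_itv /= => /andP[x0 x1].
by rewrite !payoff_gap_nondecreasing.
Qed.

(** A total function, with default value 0 at any d that the gap does not take on [0, 1]. *)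
Definition gap_inverse d : R := xget 0 [set x | x \in `[0, 1] /\ gap x = d].

Local Notation X := gap_inverse.

Lemma gap_inverseP d : gap 0 <= d <= gap 1 -> X d \in `[0, 1] /\ gap (X d) = d.
Proof.
move=> dI; rewrite /X; case: xgetP => [x _ //|nex].
have [x xI xd] := payoff_gap_onto ssig sig_incr sig_int dI.
by case: (nex x).
Qed.

Lemma gap_inverseK x : x \in `[0, 1] -> X (gap x) = x.
Proof.
move=> xI; have [XI gX] := gap_inverseP (gap_bounds xI).
exact: gap_inj.
Qed.

Let gap_pos d : 0 <= d <= gap 1 -> gap 0 <= d <= gap 1.
Proof. by move=> /andP[d0 ->]; rewrite (le_trans (ltW gap0_lt0)). Qed.

Let X_incr : {in `[0, gap 1] &, {homo X : d e / d < e}}.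
Proof.
move=> d e; rewrite !in_itv /= => /gap_pos/gap_inverseP[dI gd].
by move=> /gap_pos/gap_inverseP[eI ge] de; rewrite -gap_lt// gd ge.
Qed.

(** The gap expands distances by a factor of at least 1 - sigma 1, so its inverse is Lipschitz with
    the reciprocal constant. *)
Lemma gap_inverse_continuous : {within `[0, gap 1], continuous X}.
Proof.
apply: (@lipschitz_continuous_within _ _ _ (1 - s1)^-1) => d e.
rewrite !inE /= !in_itv /=.
wlog de : d e / d <= e.
  move=> w dI eI; have [/w|/ltW /w] := leP d e; first exact.
  by rewrite distrC (distrC e); exact.
move=> dI eI; have [XdI gd] := gap_inverseP (gap_pos dI).
have [XeI ge] := gap_inverseP (gap_pos eI).
have Xde : X d <= X e.
  move: de; rewrite le_eqVlt => /predU1P[->//|de].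
  by apply/ltW/X_incr => //; rewrite in_itv.
rewrite distrC (distrC d) !ger0_norm ?subr_ge0// mulrC ler_pdivlMr// mulrC.
by rewrite -[in leRHS]gd -[in leRHS]ge payoff_gap_expansive.
Qed.

(* The payoff gap stays in [- gap 1, gap 1]; beyond it any increasing function
   will do, and k is there to match the derivative at gap 1. *)
Definition outer_rule d : R := 1 - (1 - s1) / (1 + k * (d - gap 1)).

Definition half_rule d : R := if d <= gap 1 then sigma (X d) else outer_rule d.

Let X1 : X (gap 1) = 1.
Proof. exact: gap_inverseK. Qed.

Let tail1 : outer_rule (gap 1) = s1.
Proof. by rewrite /outer_rule subrr mulr0 addr0 divr1; lra. Qed.

Let tail_den d : gap 1 <= d -> 0 < 1 + k * (d - gap 1).
Proof. by move=> d1; rewrite ltr_pwDl// mulr_ge0 ?subr_ge0// ltW. Qed.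

Let half_inner : {in `[0, gap 1], half_rule =1 sigma \o X}.
Proof. by move=> d; rewrite in_itv /= /half_rule => /andP[_ ->]. Qed.

Let half_tail d : gap 1 <= d -> half_rule d = outer_rule d.
Proof.
rewrite le_eqVlt /half_rule => /predU1P[<-|d1]; first by rewrite lexx X1 tail1.
by rewrite leNgt d1.
Qed.

Let tail_lt1 d : gap 1 <= d -> outer_rule d < 1.
Proof. by move=> /tail_den d1; rewrite ltrBlDr ltrDl divr_gt0. Qed.

Let tail_incr d e : gap 1 <= d -> d < e -> outer_rule d < outer_rule e.
Proof.
move=> d1 de; rewrite ltrD2l ltrN2 ltr_pM2l// ltf_pV2 ?posrE ?tail_den//.
  by rewrite ltrD2l ltr_pM2l// ltrD2r.
exact: le_trans (ltW de).
Qed.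

Lemma half_rule_lt1 d : 0 <= d -> half_rule d < 1.
Proof.
move=> d0; rewrite /half_rule; case: (leP d (gap 1)) => d1.
  have dI : 0 <= d <= gap 1 by rewrite d0.
  have [XI _] := gap_inverseP (gap_pos dI).
  by case/andP: (sig_int XI).
exact/tail_lt1/ltW.
Qed.

Lemma half_rule_increasing : {in `[0, +oo[ &, {homo half_rule : x y / x < y}}.
Proof.
move=> d e; rewrite !in_itv /= !andbT => d0 e0 de.
have inner a b : 0 <= a -> b <= gap 1 -> a < b -> half_rule a < half_rule b.
  move=> a0 b1 ab.
  have aI : a \in `[0, gap 1] by rewrite in_itv /= a0 (le_trans (ltW ab)).
  have bI : b \in `[0, gap 1] by rewrite in_itv /= b1 (le_trans a0 (ltW ab)).
  rewrite !half_inner//=; apply: sig_incr; last exact: X_incr.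
    by case: (gap_inverseP (gap_pos aI)).
  by case: (gap_inverseP (gap_pos bI)).
have [e1|e1] := leP e (gap 1); first exact: inner.
have [d1|d1] := leP (gap 1) d.
  by rewrite !half_tail ?tail_incr// ltW.
(* For d < gap 1 < e the comparison passes through gap 1, where both formulas give sigma 1. *)
apply: (lt_trans (inner _ (gap 1) d0 _ d1)) => //.
by rewrite !half_tail ?tail_incr// ltW.
Qed.

Lemma positive_half_line :
  `[0, gap 1]%classic `|` `[gap 1, +oo[%classic = `[0, +oo[%classic.
Proof.
apply/seteqP; split=> d /=; rewrite !in_itv /= !andbT.
  by move=> [/andP[]//|]; exact/le_trans/ltW.
by move=> d0; rewrite d0 /=; apply/orP; exact: le_total.
Qed.

Lemma outer_rule_slope d : gap 1 <= d ->
  is_derive d 1 outer_rule ((1 - s1) * k / (1 + k * (d - gap 1)) ^+ 2).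
Proof.
move=> /tail_den/lt0r_neq0 d1.
have Dden : is_derive d 1 (fun d => 1 + k * (d - gap 1)) k.
  by apply: is_derive_eq; rewrite add0r mul1r subr0 /GRing.scale /= mulr1.
have Dinv := is_deriveV (f := fun d => 1 + k * (d - gap 1)) d1 Dden.
rewrite /outer_rule; apply: is_derive_eq.
by rewrite /GRing.scale /=; field.
Qed.

Lemma half_rule_continuous : {within `[0, +oo[, continuous half_rule}.
Proof.
rewrite -positive_half_line; apply: withinU_continuous.
- exact: interval_closed.
- exact: interval_closed.
- apply: (@subspace_eq_continuous _ _ _ (sigma \o X)).
    by move=> d; rewrite inE => dI; exact/esym/half_inner.
  apply: continuous_within_comp sig_cont gap_inverse_continuous _.
  by move=> d /gap_pos /gap_inverseP[].
- apply: (@subspace_eq_continuous _ _ _ outer_rule).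
    by move=> d; rewrite inE /= in_itv /= andbT => yI; exact/esym/half_tail.
  apply/subspace_continuousP => d; rewrite /= in_itv /= andbT => d1.
  apply: cvg_within_filter.
  have [td _] := outer_rule_slope d1.
  exact/differentiable_continuous/derivable1_diffP.
Qed.

(** Condition (iii) enters here: the inverse of the gap sends 0 to the indifferent type, where sigma
    is 1/2. *)
Lemma half_rule0 : half_rule 0 = 2^-1.
Proof.
case: shape => _ _ [x [_ [[xI gx] _] sx _]] _.
by rewrite -gx /half_rule gx ltW// -gx gap_inverseK.
Qed.

Definition extended_rule : R -> R := odd_extension half_rule.

Lemma extended_rule_choice : choice_rule extended_rule.
Proof.
apply: odd_extension_rule; [exact: half_rule0 | exact: half_rule_lt1 |
  exact: half_rule_increasing | exact: half_rule_continuous].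
Qed.

(** If gap x < 0, then B <= 1/2 puts - gap x in the range of the gap, say - gap x = gap x'. The
    extension prescribes 1 - sigma x' at gap x, and condition (iv) identifies this with sigma x. *)
Lemma extended_rule_generates : generates extended_rule B sigma.
Proof.
move=> x xI; have /andP[gx0 gx1] := gap_bounds xI.
rewrite /extended_rule /odd_extension /half_rule; case: (leP 0 (gap x)) => gx.
  by rewrite gx1 gap_inverseK.
have gxN : 0 <= - gap x <= gap 1.
  rewrite oppr_ge0 (ltW gx) /=; move: gx0; rewrite payoff_gap0// payoff_gap1//.
  have : B * flee_mass sigma <= (1 - B) * flee_mass sigma.
    by rewrite ler_pM2r//; move: B_le => ?; lra.
  lra.
have [XI gX] := gap_inverseP (gap_pos gxN).
case/andP: gxN => _ ->; case: shape => _ _ _ /(_ x _ xI XI) [_]; apply.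
by rewrite gX opprK.
Qed.

(** Up to gap 1 the rule is sigma composed with the inverse of the gap, with slope sigma' / (1 -
    sigma) at the corresponding type. At gap 1 this is l / (1 - sigma 1) from the left, while the
    outer rule has slope (1 - sigma 1) k; the value of k equates the two. *)
Lemma extended_rule_derivable l : pos_derivative sigma ->
  has_slope `[0, 1] sigma 1 l -> k = l / (1 - s1) ^+ 2 ->
  forall d, derivable extended_rule d 1 /\ 0 < derive1 extended_rule d.
Proof.
move=> sd sd1 kE; apply: odd_extension_derivable.
  exact: half_rule0.
have inner d m : 0 <= d <= gap 1 -> has_slope `[0, 1] sigma (X d) m ->
    has_slope `[0, gap 1] half_rule d (m / (1 - sigma (X d))).
  move=> dI sm; have [XI gX] := gap_inverseP (gap_pos dI).
  apply: (@has_slope_eq _ _ (sigma \o X)).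
  - by move=> y; rewrite inE => yI; exact/esym/half_inner.
  - by rewrite half_inner.
  apply: (@has_slope_comp _ _ `[0, 1]) => //.
  - apply: (@has_slope_inverse _ _ `[0, 1] (fun x => gap x)) => //.
    + exact: payoff_gap_slope.
    + by rewrite subr_eq0 gt_eqF//; case/andP: (sig_int XI).
    + exact: (continuous_within_dnbhs gap_inverse_continuous).
    + by move=> y /gap_pos /gap_inverseP[].
    + by move=> y /gap_pos /gap_inverseP[].
  - by move=> y /gap_pos /gap_inverseP[].
  - move=> y /gap_pos /gap_inverseP[_ gy].
    by apply: contra_neq => /(congr1 (fun x => gap x)); rewrite gy gX.
have outer d : gap 1 <= d -> has_slope `[gap 1, +oo[ half_rule d
    ((1 - s1) * k / (1 + k * (d - gap 1)) ^+ 2).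
  move=> d1; apply: (@has_slope_eq _ _ outer_rule).
  - by move=> y; rewrite inE /= in_itv /= andbT => yI; exact/esym/half_tail.
  - by rewrite half_tail.
  apply: (@has_slopeS _ setT) => //; apply/is_derive_slope; exact: outer_rule_slope.
move=> d d0; rewrite -positive_half_line.
have [d1|d1|d1] := ltgtP d (gap 1).
- have dI : 0 <= d <= gap 1 by rewrite d0 ltW.
  have [XI _] := gap_inverseP (gap_pos dI).
  have [m m0 sm] := sd _ XI; exists (m / (1 - sigma (X d))).
    by rewrite divr_gt0// subr_gt0; case/andP: (sig_int XI).
  apply: has_slopeU; first exact: inner.
  apply: (@has_slope_far _ _ _ _ _ (gap 1 - d)); first by rewrite subr_gt0.
  move=> y; rewrite /= in_itv /= andbT => y1.
  by rewrite ger0_norm; lra.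
- exists ((1 - s1) * k / (1 + k * (d - gap 1)) ^+ 2).
    by rewrite divr_gt0 ?mulr_gt0 ?exprn_gt0 ?tail_den// ltW.
  apply: has_slopeU; last exact/outer/ltW.
  apply: (@has_slope_far _ _ _ _ _ (d - gap 1)); first by rewrite subr_gt0.
  move=> y; rewrite /= in_itv /= => /andP[_ y1].
  by rewrite ler0_norm; lra.
- have slopeE : (1 - s1) * k / (1 + k * (d - gap 1)) ^+ 2 = l / (1 - s1).
    rewrite d1 subrr mulr0 addr0 expr1n divr1 kE.
    by field; exact: lt0r_neq0.
  have := outer d; rewrite slopeE d1 lexx => /(_ isT) sout.
  exists (l / (1 - s1)).
    by rewrite -slopeE d1 subrr mulr0 addr0 expr1n divr1 mulr_gt0.
  apply: has_slopeU => //.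
  have := inner (gap 1) l; rewrite X1; apply => //.
  by rewrite lexx ltW.
Qed.

End ShapeToRule.

(** * Exponential strategies with a prescribed indifferent type *)

Section ExponentialStrategy.
Context {R : realType}.
Variables (B x0 c : R).
Hypotheses (B_gt0 : 0 < B) (B_le : B <= 2^-1) (x0_gt0 : 0 < x0) (x0_lt1 : x0 < 1)
  (c_gt0 : 0 < c) (cE : 1 - expR (- c * x0) = B * (1 - expR (- c))).
Implicit Types x y : R.

Definition exp_strategy x : R := 1 - 2^-1 * expR (- c * (x - x0)).

Local Notation s := exp_strategy.

Let in01_x0 : x0 \in `[0, 1].
Proof. by rewrite in_itv /= !ltW. Qed.

Let expc : expR (- c * x0) * expR (c * x0) = 1.
Proof. by rewrite -expRD mulNr addNr expR0. Qed.

Lemma exp_strategy_derive x : is_derive x 1 s (c * (1 - s x)).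
Proof.
rewrite /s; apply: is_derive_eq.
by rewrite /GRing.scale /=; ring.
Qed.

Lemma exp_strategy_lt1 x : s x < 1.
Proof. by rewrite /s; have := expR_gt0 (- c * (x - x0)); lra. Qed.

Lemma exp_strategy_increasing : {homo s : x y / x < y}.
Proof.
move=> x y xy; rewrite /s ltrD2l ltrN2 ltr_pM2l// ltr_expR !mulNr ltrN2.
by rewrite ltr_pM2l// ltrD2r.
Qed.

(** At 0 this is where B <= 1/2 is used: [cE] gives 1 - exp (- c x0) < B <= 1/2, hence exp (c x0) <
    2 and s 0 > 0. *)
Lemma exp_strategy_gt0 x : 0 <= x -> 0 < s x.
Proof.
move=> x_ge0.
have s0 : 0 < s 0.
  rewrite /s sub0r mulrNN.
  have e1 : 2^-1 < expR (- c * x0).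
    have : B * (1 - expR (- c)) < B.
      by rewrite gtr_pMr//; have := expR_gt0 (- c); lra.
    by rewrite -cE; move: B_le => ?; lra.
  have e2 := expR_gt0 (c * x0).
  have : 2^-1 * expR (c * x0) < 1 by rewrite -[ltRHS]expc ltr_pM2r.
  lra.
move: x_ge0; rewrite le_eqVlt => /predU1P[<-//|/exp_strategy_increasing].
exact: lt_trans.
Qed.

Lemma exp_strategy_continuous : {within `[0, 1], continuous s}.
Proof.
apply: continuous_subspaceT => x.
by apply/differentiable_continuous/derivable1_diffP; case: (exp_strategy_derive x).
Qed.

Lemma exp_strategy_int x : x \in `[0, 1] -> 0 < s x < 1.
Proof.
by rewrite in_itv /= => /andP[/exp_strategy_gt0 -> _]; exact: exp_strategy_lt1.
Qed.

Lemma exp_strategyP : strategy s.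
Proof.
apply: continuous_strategy; first exact: exp_strategy_continuous.
by move=> x /exp_strategy_int /andP[/ltW -> /ltW ->].
Qed.

Local Notation gap x := (payoff_gap B x s).

(** Since s' = c (1 - s), both the gap and s / c have derivative 1 - s. *)
Lemma exp_strategy_gap_cst x : x \in `[0, 1] ->
  gap x - c^-1 * s x = gap 0 - c^-1 * s 0.
Proof.
rewrite in_itv /= => /andP[x_ge0 x_le1]; pose f x := gap x - c^-1 * s x.
suff [y _ /eqP] : exists2 y, y \in `[0, x] & f x - f 0 = 0 * (x - 0).
  by rewrite mul0r subr_eq0 => /eqP.
apply: (MVT_segment (df := fun=> 0) x_ge0).
  move=> y; rewrite in_itv /= => /andP[y0 yx].
  have y1 : y < 1 by lra.
  have Dgap : is_derive y 1 (fun x => gap x) (1 - s y).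
    apply: (@has_slope_is_derive _ 0 1); first by rewrite y0.
    apply: payoff_gap_slope; first exact: exp_strategyP.
      exact: exp_strategy_continuous.
    by rewrite in_itv /= !ltW.
  have Ds := exp_strategy_derive y.
  rewrite /f; apply: is_derive_eq.
  by rewrite /GRing.scale /= mulrA mulVf ?lt0r_neq0// mul1r subrr.
apply: (@continuous_subspaceW _ _ _ (`[0, 1]%classic : set R)).
  by apply: subset_itvl; rewrite bnd_simp.
have /subspace_continuousP gc := payoff_gap_continuous (B := B) exp_strategyP.
have /subspace_continuousP sc := exp_strategy_continuous.
apply/subspace_continuousP => y yI; apply: cvgB; first exact: gc.
by apply: cvgM; [exact: cvg_cst | exact: sc].
Qed.

(** So s is the affine function 1/2 + c d of the gap d, which makes condition (iv) immediate and
    places the zero of the gap at x0. *)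
Lemma exp_strategy_gap x : x \in `[0, 1] -> gap x = c^-1 * (s x - 2^-1).
Proof.
move=> xI; have := exp_strategy_gap_cst xI.
have /exp_strategy_gap_cst : (1 : R) \in `[0, 1] by rewrite in_itv /= lexx ler01.
rewrite payoff_gap0 ?payoff_gap1; try exact: exp_strategyP.
set m := flee_mass s => h1 hx.
(* The gap grows by m from 0 to 1, so constancy of gap - s / c yields m. The equation [cE] then
   turns B m, which is - gap 0, into (1/2 - s 0) / c and so fixes the constant. *)
have mE : m = c^-1 * (s 1 - s 0) by rewrite mulrBr; lra.
have Bm : B * m = c^-1 * (2^-1 - s 0).
  rewrite mE mulrCA; congr (_ * _).
  rewrite /s sub0r mulrNN.
  have -> : expR (- c * (1 - x0)) = expR (- c) * expR (c * x0).
    by rewrite -expRD; congr expR; ring.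
  transitivity (2^-1 * expR (c * x0) * (B * (1 - expR (- c)))); first ring.
  rewrite -cE; transitivity (2^-1 * expR (c * x0) -
    2^-1 * (expR (- c * x0) * expR (c * x0))); first ring.
  by rewrite expc; field.
move: hx; rewrite Bm !mulrBr; lra.
Qed.

Lemma exp_strategy_half : s x0 = 2^-1.
Proof. by rewrite /s subrr mulr0 expR0 mulr1; lra. Qed.

Lemma exp_strategy_shape : qre_shape B s.
Proof.
have B_lt1 : B < 1 by move: B_le => ?; lra.
have incr : {in `[0, 1] &, {homo s : x y / x < y}}.
  by move=> x y _ _; exact: exp_strategy_increasing.
have [x [xB xu xE]] :=
  indifferent_type exp_strategyP B_gt0 B_lt1 incr exp_strategy_int.
split.
- by split; [exact: exp_strategy_continuous | exact: incr].
- exact: exp_strategy_int.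
- exists x; split => //; case: xu => _ /(_ x0) ->; first exact: exp_strategy_half.
  by split=> //; rewrite exp_strategy_gap// exp_strategy_half subrr mulr0.
- move=> y z yI zI; rewrite !exp_strategy_gap// -mulrN; split=> [->|].
    by congr (_ * _); lra.
  by move=> /(mulfI (invr_neq0 (lt0r_neq0 c_gt0))); lra.
Qed.

Lemma exp_strategy_indifferent : unique (indifferent B s) x0.
Proof.
have [_ _ [x [_ xu _ _]] _] := exp_strategy_shape.
suff <- : x = x0 by [].
apply: xu.2; split=> //.
by rewrite exp_strategy_gap// exp_strategy_half subrr mulr0.
Qed.

Lemma exp_strategy_pos_derivative : pos_derivative s.
Proof.
move=> x xI; exists (c * (1 - s x)).
  by rewrite mulr_gt0// subr_gt0 exp_strategy_lt1.
apply: (@has_slopeS _ setT) => //.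
exact/is_derive_slope/exp_strategy_derive.
Qed.

End ExponentialStrategy.

(** The difference F of the two sides vanishes at c = 0 with slope x0 - B < 0 and tends to 1 - B >
    0, so it has a positive zero. The intermediate value theorem is applied on an explicit interval
    that excludes 0. *)
Lemma exp_strategy_rate (R : realType) (B x0 : R) : B <= 2^-1 -> 0 < x0 -> x0 < B ->
  exists2 c, 0 < c & 1 - expR (- c * x0) = B * (1 - expR (- c)).
Proof.
move=> B_le x0_gt0 x0_lt.
pose F c := 1 - expR (- c * x0) - B * (1 - expR (- c)).
(* From 1 - exp (- c x0) <= c x0 and exp (- c) <= 1 / (1 + c), F c <= 0 holds once x0 (1 + c) <= B;
   [c1] makes the left side the midpoint of x0 and B. At [c2] the first exponential is exp (- 2) <=
   1/3, so F c2 >= 2/3 - B > 0. *)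
pose c1 := (B / x0 - 1) / 2; pose c2 := 2 / x0.
have Bx : 1 < B / x0 by rewrite ltr_pdivlMr// mul1r.
have c1_gt0 : 0 < c1 by rewrite /c1; lra.
have c12 : c1 <= c2.
  have : B / x0 <= 2 / x0 by rewrite ler_pM2r ?invr_gt0//; lra.
  have : 0 < x0^-1 by rewrite invr_gt0.
  by rewrite /c1 /c2; lra.
have expN (y : R) : 0 < y -> expR (- y) <= (1 + y)^-1.
  move=> y0; rewrite expRN lef_pV2 ?posrE ?expR_gt0 ?expR_ge1Dx//; lra.
have F1 : F c1 <= 0.
  have h1 := expR_ge1Dx (- c1 * x0).
  have h2 := expN _ c1_gt0.
  have c1x : x0 * (1 + c1) = (x0 + B) / 2.
    by rewrite /c1; field; exact: lt0r_neq0.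
  have h3 : c1 * x0 <= B * (1 - (1 + c1)^-1).
    have -> : B * (1 - (1 + c1)^-1) = c1 * B / (1 + c1) by field; lra.
    rewrite ler_pdivlMr; last lra.
    by rewrite -mulrA ler_pM2l// c1x; lra.
  have h4 : B * (1 - (1 + c1)^-1) <= B * (1 - expR (- c1)).
    by rewrite ler_pM2l; lra.
  by rewrite /F; lra.
have F2 : 0 <= F c2.
  have := expN 2 (ltr0n _ 2); rewrite (_ : (1 + 2)^-1 = 3^-1); last by field.
  move=> h1.
  have -> : F c2 = 1 - expR (- 2) - B * (1 - expR (- c2)).
    by rewrite /F /c2 mulNr divfK// lt0r_neq0.
  have h2 : B * (1 - expR (- c2)) <= B.
    by rewrite ger_pMr; have := expR_gt0 (- c2); lra.
  lra.
have Fc : {within `[c1, c2], continuous F}.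
  apply: continuous_subspaceT => c.
  apply/differentiable_continuous/derivable1_diffP; rewrite /F; exact: ex_derive.
have [|c cI Fc0] := IVT c12 Fc (v := 0).
  by rewrite (min_idPl (le_trans F1 F2)) (max_idPr (le_trans F1 F2)) F1.
exists c; last by apply/eqP; rewrite -subr_eq0; apply/eqP.
by move: cI; rewrite in_itv /= => /andP[+ _]; exact: lt_le_trans.
Qed.

(** * Characterisation of sym-QRE and of their indifferent types *)

Theorem proposition8 (R : realType) (B : R) (B_gt0 : 0 < B) (B_le : B <= 2^-1) :
  (indifferent_types responsive B = (`]0, B[)%classic /\
   indifferent_types strictly_responsive B = (`]0, B[)%classic) /\
  forall sigma : R -> R, strategy sigma ->
    (sym_QRE responsive B sigma <-> qre_shape B sigma /\ pos_derivative sigma) /\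
    (sym_QRE strictly_responsive B sigma <-> qre_shape B sigma).
Proof.
have B_lt1 : B < 1 by lra.
have strictP (sigma : R -> R) : strategy sigma ->
    (sym_QRE strictly_responsive B sigma <-> qre_shape B sigma).
  move=> ssig; split=> [/strict_sym_QREP[h hr hsig]|shape].
    exact: (generated_qre_shape ssig B_gt0 B_lt1 hr hsig).
  (* Any positive k would do, as no derivatives have to be matched at gap 1. *)
  apply/strict_sym_QREP; exists (extended_rule B sigma 1).
    exact: extended_rule_choice.
  exact: extended_rule_generates.
have respP (sigma : R -> R) : strategy sigma ->
    (sym_QRE responsive B sigma <-> qre_shape B sigma /\ pos_derivative sigma).
  move=> ssig; split=> [/responsive_sym_QREP[h [hr hsig hd]]|[shape sd]].
    split; first exact: (generated_qre_shape ssig B_gt0 B_lt1 hr hsig).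
    exact: (generated_pos_derivative ssig hr hsig hd).
  have in01_1 : (1 : R) \in `[0, 1] by rewrite in_itv /= lexx ler01.
  have s1 : 0 < 1 - sigma 1.
    by case: shape => _ /(_ _ in01_1) /andP[_] ? _ _; rewrite subr_gt0.
  have [l l0 sl] := sd 1 in01_1.
  have k0 : 0 < l / (1 - sigma 1) ^+ 2 by rewrite divr_gt0// exprn_gt0.
  apply/responsive_sym_QREP.
  exists (extended_rule B sigma (l / (1 - sigma 1) ^+ 2)); split.
  - exact: extended_rule_choice.
  - exact: extended_rule_generates.
  - exact: extended_rule_derivable sl _.
(* Both forms of responsiveness are treated at once: the exponential strategies satisfy the shape
   conditions and have a positive derivative, so they are sym-QRE in either sense. *)
have typesP resp :
    (forall sigma, strategy sigma -> sym_QRE resp B sigma -> qre_shape B sigma) ->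
    (forall sigma, strategy sigma -> qre_shape B sigma -> pos_derivative sigma ->
      sym_QRE resp B sigma) ->
    indifferent_types resp B = `]0, B[%classic.
  move=> to_shape of_shape; apply/seteqP; split=> x.
    move=> [sigma [ssig /(to_shape _ ssig) [_ _ [y [yB yu _ _]] _] [xi xu]]].
    by rewrite (xu y yu.1).
  rewrite /= in_itv /= => /andP[x_gt0 xB].
  have [c c0 cE] := exp_strategy_rate B_le x_gt0 xB.
  have x_lt1 : x < 1 by lra.
  have ssig : strategy (exp_strategy x c) by apply: exp_strategyP cE.
  exists (exp_strategy x c); split=> //.
  - apply: of_shape => //; last exact: exp_strategy_pos_derivative.
    by apply: exp_strategy_shape cE.
  - by apply: exp_strategy_indifferent cE.
split; last by move=> sigma ssig; split; [exact: respP | exact: strictP].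
split; apply: typesP => sigma ssig.
- by move=> /(respP _ ssig)[].
- by move=> ? ?; apply/(respP _ ssig).
- by move=> /(strictP _ ssig).
- by move=> ? _; apply/(strictP _ ssig).
Qed.
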